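(* Let $\{\mathbb{X}_n\}_{n\in\mathbb{N}}$ be a sequence of non-trivial normed linear spaces over $\mathbb{K}$ and let $x=\{x_n\}_{n\in\mathbb{N}}\in\bigoplus_2\mathbb{X}_n$. Then: (1) $x$ is left-symmetric if and only if either $x_n\in\mathbb{X}_n$ is left s.i.p. symmetric for every $n\in\mathbb{N}$, or there exists $n_0\in\mathbb{N}$ such that $x_n=0$ if $n\neq n_0$ and $x_{n_0}$ is a left-symmetric point of $\mathbb{X}_{n_0}$. (2) $x$ is right-symmetric if and only if either $x_n\in\mathbb{X}_n$ is right s.i.p. symmetric for every $n\in\mathbb{N}$, or there exists $n_0\in\mathbb{N}$ such that $x_n=0$ if $n\neq n_0$ and $x_{n_0}$ is a right-symmetric point of $\mathbb{X}_{n_0}$.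
   Context: $\mathbb{K}=\mathbb{R}$ or $\mathbb{C}$; non-trivial means of dimension more than $0$. $\bigoplus_2\mathbb{X}_n$ is the space of sequences $\{x_n\}$ with $x_n\in\mathbb{X}_n$ and $\sum_n\|x_n\|^2<\infty$, with norm $\|\{x_n\}\|_2=(\sum_n\|x_n\|^2)^{1/2}$. In a normed space $\mathbb{X}$, $x\perp_By$ means $\|x+\lambda y\|\ge\|x\|$ for every scalar $\lambda\in\mathbb{K}$. A point $x\in\mathbb{X}$ is left-symmetric if $x\perp_By\Rightarrow y\perp_Bx$ for every $y\in\mathbb{X}$, and right-symmetric if $y\perp_Bx\Rightarrow x\perp_By$ for every $y\in\mathbb{X}$. A semi-inner product (s.i.p.) on a normed space $\mathbb{X}$ is a map $[\cdot,\cdot]:\mathbb{X}\times\mathbb{X}\to\mathbb{K}$ with, for $x,y,z\in\mathbb{X}$, $\lambda\in\mathbb{K}$: $[x,x]=\|x\|^2$; $[x,y]+\lambda[x,z]=[x,y+\lambda z]$; $[\lambda x,y]=\overline{\lambda}[x,y]$; $|[x,y]|^2\le[x,x][y,y]$. A point $x\in\mathbb{X}$ is left s.i.p. symmetric if for every non-zero $y\in\mathbb{X}$ and every s.i.p. $[\cdot,\cdot]$ on $\mathbb{X}$ there is an s.i.p. $[\cdot,\cdot]'$ on $\mathbb{X}$ with $[y,x]'=\overline{[x,y]}$; it is right s.i.p. symmetric if for every non-zero $y\in\mathbb{X}$ and every s.i.p. $[\cdot,\cdot]$ there is an s.i.p. $[\cdot,\cdot]'$ with $[y,x]=\overline{[x,y]'}$.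 *)

(* Defs.v *)
From HB Require Import structures.
From mathcomp Require Import all_boot all_order all_algebra.
From mathcomp Require Import complex ring.
From mathcomp Require Import boolp classical_sets functions reals topology.
From mathcomp Require Import normedtype sequences.

Set Implicit Arguments.
Unset Strict Implicit.
Unset Printing Implicit Defensive.

Import Order.TTheory GRing.Theory Num.Theory.
Import numFieldNormedType.Exports.

Local Open Scope classical_set_scope.
Local Open Scope ring_scope.

Variant scalar_kind := RealScalars | ComplexScalars.

Definition scalars (R : realType) (k : scalar_kind) : numFieldType :=
  match k with RealScalars => R | ComplexScalars => R[i]%C end.

Definition sconj (R : realType) (k : scalar_kind) :
    scalars R k -> scalars R k :=
  match k with
  | RealScalars => fun a : R => a
  | ComplexScalars => fun a : R[i]%C => conjc a
  end.

Definition sre (R : realType) (k : scalar_kind) : scalars R k -> R :=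
  match k with
  | RealScalars => fun a : R => a
  | ComplexScalars => fun a : R[i]%C => complex.Re a
  end.

Definition of_real (R : realType) (k : scalar_kind) : R -> scalars R k :=
  match k with
  | RealScalars => fun a : R => a
  | ComplexScalars => fun a : R => real_complex R a
  end.
Arguments of_real {R} k.

Section birkhoff_james.
Context {K : numFieldType} {V : normedModType K}.

Definition bj_orth (x y : V) : Prop := forall l : K, `|x| <= `|x + l *: y|.

Definition left_symmetric (x : V) : Prop :=
  forall y, bj_orth x y -> bj_orth y x.

Definition right_symmetric (x : V) : Prop :=
  forall y, bj_orth y x -> bj_orth x y.

End birkhoff_james.

Section semi_inner_product.
Context {R : realType} {k : scalar_kind} {V : normedModType (scalars R k)}.
Local Notation K := (scalars R k).

(* Linear in the second argument and conjugate-homogeneous in the first.  The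
   order on complex scalars compares real parts of numbers with equal imaginary
   parts, so the last clause is an inequality between nonnegative reals. *)
Definition is_sip (s : V -> V -> K) : Prop :=
  [/\ forall x, s x x = `|x| ^+ 2,
      forall x y z (l : K), s x y + l * s x z = s x (y + l *: z),
      forall x y (l : K), s (l *: x) y = sconj l * s x y
    & forall x y, `|s x y| ^+ 2 <= s x x * s y y].

Definition left_sip_symmetric (x : V) : Prop :=
  forall y, y != 0 -> forall s, is_sip s ->
    exists2 s', is_sip s' & s' y x = sconj (s x y).

Definition right_sip_symmetric (x : V) : Prop :=
  forall y, y != 0 -> forall s, is_sip s ->
    exists2 s', is_sip s' & s y x = sconj (s' x y).

End semi_inner_product.

Section scalars_theory.
Context {R : realType} {k : scalar_kind}.
Local Notation K := (scalars R k).

Lemma sreK (a : K) : 0 <= a -> of_real k (sre a) = a.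
Proof.
case: k a => [//|] /= [a b] /=; rewrite lecE /= => /andP[/eqP -> _].
by [].
Qed.

Lemma of_realK : cancel (of_real k) (@sre R k).
Proof. by case: k. Qed.

Lemma of_realD (a b : R) : of_real k (a + b) = of_real k a + of_real k b.
Proof. by case: k => //=; rewrite rmorphD. Qed.

Lemma of_realM (a b : R) : of_real k (a * b) = of_real k a * of_real k b.
Proof. by case: k => //=; rewrite rmorphM. Qed.

Lemma of_real_le (a b : R) : (of_real k a <= of_real k b) = (a <= b).
Proof. by case: k => //=; rewrite lecR. Qed.

Lemma of_real0 : of_real k 0 = 0 :> K.
Proof. by case: k. Qed.

(* The norm of a normed module over K takes its values in K; rnorm is the same
   nonnegative number read in R. *)
Definition rnorm {V : normedModType K} (v : V) : R := sre `|v|.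

Section rnorm.
Context {V : normedModType K}.
Implicit Types v w : V.

Lemma rnormE v : of_real k (rnorm v) = `|v|.
Proof. exact: sreK. Qed.

Lemma rnorm_ge0 v : 0 <= rnorm v.
Proof. by rewrite -of_real_le rnormE of_real0. Qed.

Lemma rnorm0 : rnorm (0 : V) = 0.
Proof. by rewrite /rnorm normr0 -of_real0 of_realK. Qed.

Lemma rnorm_eq0 v : rnorm v = 0 -> v = 0.
Proof. by move=> v0; apply/eqP; rewrite -normr_eq0 -rnormE v0 of_real0. Qed.

Lemma ler_rnormD v w : rnorm (v + w) <= rnorm v + rnorm w.
Proof. by rewrite -of_real_le of_realD !rnormE ler_normD. Qed.

Lemma rnormZ (l : K) v : rnorm (l *: v) = sre `|l| * rnorm v.
Proof.
by apply: (can_inj of_realK); rewrite of_realM !rnormE normrZ sreK.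
Qed.

End rnorm.
End scalars_theory.

Section square_summable.
Context {R : realType}.
Implicit Types a b : nat -> R.

Definition square_summable a : Prop := cvgn (series (fun n => a n ^+ 2)).

Definition l2_norm a : R := Num.sqrt (limn (series (fun n => a n ^+ 2))).

Let nd_series a : (forall n, 0 <= a n) -> nondecreasing_seq (series a).
Proof.
move=> a0; apply/nondecreasing_seqP => n.
by rewrite /series/= big_nat_recr//= lerDl.
Qed.

Let nd_sqr a : nondecreasing_seq (series (fun n => a n ^+ 2)).
Proof. by apply: nd_series => n; exact: sqr_ge0. Qed.

Let le_limn_sqr a n : square_summable a ->
  series (fun n => a n ^+ 2) n <= limn (series (fun n => a n ^+ 2)).
Proof. by move=> ca; apply: nondecreasing_cvgn_le => //; exact: nd_sqr. Qed.

Let limn_sqr_ge0 a : square_summable a ->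
  0 <= limn (series (fun n => a n ^+ 2)).
Proof. by move=> /(@le_limn_sqr a 0); rewrite /series/= big_geq. Qed.

Lemma l2_norm_ge0 a : 0 <= l2_norm a.
Proof. exact: sqrtr_ge0. Qed.

Lemma sqr_l2_norm a : square_summable a ->
  l2_norm a ^+ 2 = limn (series (fun n => a n ^+ 2)).
Proof. by move=> /limn_sqr_ge0; exact: sqr_sqrtr. Qed.

Lemma square_summable_bound a (M : R) :
  (forall n, series (fun n => a n ^+ 2) n <= M) -> square_summable a.
Proof.
move=> aM; apply: nondecreasing_is_cvgn; first exact: nd_sqr.
by exists M => _ [n _ <-].
Qed.

Lemma l2_norm_bound a (M : R) : 0 <= M ->
  (forall n, series (fun n => a n ^+ 2) n <= M ^+ 2) -> l2_norm a <= M.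
Proof.
move=> M0 aM; rewrite -(@ler_pXn2r _ 2) ?nnegrE ?l2_norm_ge0//.
rewrite sqr_l2_norm; last exact: square_summable_bound aM.
apply: limr_le; first exact: square_summable_bound aM.
by apply: nearW => n; exact: aM.
Qed.

Lemma l2_norm_eq0 a : square_summable a -> l2_norm a = 0 -> forall n, a n = 0.
Proof.
move=> ca a0 n; apply/eqP; rewrite -sqrf_eq0 eq_le sqr_ge0 andbT.
have := le_limn_sqr n.+1 ca; rewrite -sqr_l2_norm// a0 expr0n/=.
rewrite /series/= big_nat_recr//=; apply: le_trans; rewrite lerDr.
by apply: sumr_ge0 => i _; exact: sqr_ge0.
Qed.

Lemma series_minkowski a b : square_summable a -> square_summable b ->
  (forall n, 0 <= a n) -> (forall n, 0 <= b n) ->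
  forall n, series (fun n => (a n + b n) ^+ 2) n
            <= (l2_norm a + l2_norm b) ^+ 2.
Proof.
move=> ca cb a0 b0 n.
have [sa0|sa0] := eqVneq (l2_norm a) 0.
  rewrite sa0 add0r sqr_l2_norm//.
  under [X in series X]funext do rewrite (l2_norm_eq0 ca sa0) add0r.
  exact: le_limn_sqr.
have [sb0|sb0] := eqVneq (l2_norm b) 0.
  rewrite sb0 addr0 sqr_l2_norm//.
  under [X in series X]funext do rewrite (l2_norm_eq0 cb sb0) addr0.
  exact: le_limn_sqr.
have := le_limn_sqr n ca; have := le_limn_sqr n cb.
rewrite -!sqr_l2_norm//.
have {}sa0 : 0 < l2_norm a by rewrite lt_def sa0 l2_norm_ge0.
have {}sb0 : 0 < l2_norm b by rewrite lt_def sb0 l2_norm_ge0.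
move: (l2_norm a) (l2_norm b) sa0 sb0 => s t s0 t0 leb lea.
have -> : (s + t) ^+ 2 = (1 + t / s) * s ^+ 2 + (1 + s / t) * t ^+ 2.
  by field; rewrite !gt_eqF.
apply: (@le_trans _ _ ((1 + t / s) * series (fun n => a n ^+ 2) n
                     + (1 + s / t) * series (fun n => b n ^+ 2) n)).
  rewrite /series/= !mulr_sumr -big_split/=; apply: ler_sum => i _.
  rewrite -subr_ge0.
  have -> : (1 + t / s) * a i ^+ 2 + (1 + s / t) * b i ^+ 2 - (a i + b i) ^+ 2
      = (t * a i - s * b i) ^+ 2 / (s * t).
    by field; rewrite !gt_eqF.
  by rewrite divr_ge0 ?sqr_ge0// mulr_ge0// ltW.
by apply: lerD; apply: ler_wpM2l => //; rewrite addr_ge0// divr_ge0// ltW.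
Qed.

Lemma le_series_sqr a b n : (forall n, 0 <= a n) -> (forall n, a n <= b n) ->
  series (fun n => a n ^+ 2) n <= series (fun n => b n ^+ 2) n.
Proof.
move=> a0 ab; apply: ler_sum => i _.
by rewrite ler_pXn2r ?nnegrE// (le_trans (a0 i)).
Qed.

Lemma square_summableZ (c : R) a :
  square_summable a -> square_summable (fun n => c * a n).
Proof.
move=> ca; rewrite /square_summable.
under [X in series X]funext do rewrite exprMn.
exact: (is_cvg_seriesZ (f := fun n => a n ^+ 2)).
Qed.

Lemma l2_normZ (c : R) a : 0 <= c -> square_summable a ->
  l2_norm (fun n => c * a n) = c * l2_norm a.
Proof.
move=> c0 ca; rewrite /l2_norm.
under [X in series X]funext do rewrite exprMn.
rewrite (lim_seriesZ (f := fun n => a n ^+ 2))// sqrtrM ?sqr_ge0//.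
by rewrite sqrtr_sqr ger0_norm.
Qed.

End square_summable.

Section l2_sum.
Context {R : realType} {k : scalar_kind}.
Context (X : nat -> normedModType (scalars R k)).
Local Notation K := (scalars R k).

Record l2_sum := L2Sum {
  l2_val :> forall n, X n ;
  l2_valP : square_summable (fun n => rnorm (l2_val n)) }.

Arguments l2_valP : clear implicits.

Lemma l2_eqP (x y : l2_sum) : (forall n, x n = y n) -> x = y.
Proof.
case: x y => [x xP] [y yP]/= xy; have {}xy : x = y.
  exact: functional_extensionality_dep.
by subst y; congr L2Sum; exact: Prop_irrelevance.
Qed.

Let minkowski_bound (x y : l2_sum) n :
  series (fun n => rnorm (x n + y n) ^+ 2) n <=
  (l2_norm (fun n => rnorm (x n)) + l2_norm (fun n => rnorm (y n))) ^+ 2.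
Proof.
have x0 i : 0 <= rnorm (x i) by exact: rnorm_ge0.
have y0 i : 0 <= rnorm (y i) by exact: rnorm_ge0.
have := series_minkowski (l2_valP x) (l2_valP y) x0 y0 n.
apply: le_trans.
by apply: le_series_sqr => i; [exact: rnorm_ge0|exact: ler_rnormD].
Qed.

Let zeroP : square_summable (fun n => rnorm (0 : X n)).
Proof.
apply: (@square_summable_bound _ _ 0) => n; rewrite /series/= big1// => i _.
by rewrite rnorm0 expr0n.
Qed.

Let addP (x y : l2_sum) : square_summable (fun n => rnorm (x n + y n)).
Proof. exact: square_summable_bound (minkowski_bound x y). Qed.

Let scaleP (l : K) (x : l2_sum) : square_summable (fun n => rnorm (l *: x n)).
Proof.
under [X in square_summable X]funext do rewrite rnormZ.
exact: square_summableZ (l2_valP x).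
Qed.

Let oppP (x : l2_sum) : square_summable (fun n => rnorm (- x n)).
Proof.
under [X in square_summable X]funext do rewrite -scaleN1r.
exact: scaleP.
Qed.

Definition l2_zero := L2Sum (@zeroP).
Definition l2_add (x y : l2_sum) := L2Sum (@addP x y).
Definition l2_opp (x : l2_sum) := L2Sum (@oppP x).
Definition l2_scale (l : K) (x : l2_sum) := L2Sum (@scaleP l x).

HB.instance Definition _ := gen_eqMixin l2_sum.
HB.instance Definition _ := gen_choiceMixin l2_sum.

Let addA : associative l2_add.
Proof. by move=> x y z; apply: l2_eqP => n; exact: addrA. Qed.
Let addC : commutative l2_add.
Proof. by move=> x y; apply: l2_eqP => n; exact: addrC. Qed.
Let add0 : left_id l2_zero l2_add.
Proof. by move=> x; apply: l2_eqP => n; exact: add0r. Qed.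
Let addN : left_inverse l2_zero l2_opp l2_add.
Proof. by move=> x; apply: l2_eqP => n; exact: addNr. Qed.

HB.instance Definition _ := GRing.isZmodule.Build l2_sum addA addC add0 addN.

Let scaleA (a b : K) (x : l2_sum) :
  l2_scale a (l2_scale b x) = l2_scale (a * b) x.
Proof. by apply: l2_eqP => n; exact: scalerA. Qed.
Let scale1 : left_id 1 l2_scale.
Proof. by move=> x; apply: l2_eqP => n; exact: scale1r. Qed.
Let scaleDr : right_distributive l2_scale +%R.
Proof. by move=> a x y; apply: l2_eqP => n; exact: scalerDr. Qed.
Let scaleDl (x : l2_sum) : {morph l2_scale^~ x : a b / a + b}.
Proof. by move=> a b; apply: l2_eqP => n; exact: scalerDl. Qed.

HB.instance Definition _ :=
  GRing.Zmodule_isLmodule.Build K l2_sum scaleA scale1 scaleDr scaleDl.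

Definition l2_sum_norm (x : l2_sum) : K :=
  of_real k (l2_norm (fun n => rnorm (x n))).

Let normD (x y : l2_sum) :
  l2_sum_norm (x + y) <= l2_sum_norm x + l2_sum_norm y.
Proof.
rewrite -of_realD of_real_le; apply: l2_norm_bound.
  by rewrite addr_ge0 ?l2_norm_ge0.
exact: minkowski_bound.
Qed.

Let normZ (l : K) (x : l2_sum) : l2_sum_norm (l *: x) = `|l| * l2_sum_norm x.
Proof.
rewrite /l2_sum_norm.
under [X in l2_norm X]funext do rewrite rnormZ.
rewrite l2_normZ; last exact: l2_valP.
  by rewrite of_realM sreK.
by rewrite -(of_real_le (k := k)) sreK// of_real0.
Qed.

Let norm_eq0 (x : l2_sum) : l2_sum_norm x = 0 -> x = 0.
Proof.
move=> x0; apply: l2_eqP => n; apply: rnorm_eq0.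
apply: (l2_norm_eq0 (l2_valP x)).
by apply: (can_inj (@of_realK _ k)); rewrite of_real0.
Qed.

HB.instance Definition _ :=
  Lmodule_isNormed.Build K l2_sum normD normZ norm_eq0.

End l2_sum.

(* Main.v *)
(* Let D(x, y) be the set of values f(y) of the functionals f with f(x) = |x|^2
   and |f| = |x|.  Being such a functional amounts to
   |x|^2 + 2 Re f(v) <= |x + v|^2 for all v, so by the Hahn-Banach theorem
   D(x, y) consists of the c with |x|^2 + 2 Re(b c) <= |x + b y|^2 for all
   scalars b; in particular x is orthogonal to y iff 0 is in D(x, y).  Every such
   functional extends to a semi-inner product, hence x is left (right) s.i.p.
   symmetric iff conjugation maps D(x, y) into D(y, x) (D(y, x) into D(x, y)) for
   all y.

   In the l2-sum the increment |x + v|^2 - |x|^2 for v in the n-th summand only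
   involves x_n, so x is orthogonal to y iff there are c_n in D(x_n, y_n) with
   sum 0.  Conjugating the c_n gives the "if" parts.  Conversely, given c in
   D(x_n, y) and m <> n with x_m <> 0, the vector with components y at n and
   - c x_m / |x_m|^2 at m is orthogonal to x on the right, and orthogonality in
   the other order forces the conjugate of c to be in D(y, x_n). *)

Require Import Defs.
From mathcomp Require Import all_boot all_order all_algebra.
From mathcomp Require Import complex ring lra.
From mathcomp Require Import boolp classical_sets functions reals topology.
From mathcomp Require Import normedtype sequences realfun.

Set Implicit Arguments.
Unset Strict Implicit.
Unset Printing Implicit Defensive.

Import Order.TTheory GRing.Theory Num.Theory.
Import numFieldNormedType.Exports.

Local Open Scope classical_set_scope.
Local Open Scope ring_scope.

(** * Real and complex scalars *)

Section scalars.
Context {R : realType} {k : scalar_kind}.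
Local Notation K := (scalars R k).
Implicit Types (a b : K) (r : R).

Lemma sreD a b : sre (a + b) = sre a + sre b.
Proof. by case: k a b => //= -[? ?] [? ?]. Qed.

Lemma sreN a : sre (- a) = - sre a.
Proof. by case: k a => //= -[? ?]. Qed.

Lemma sre0 : sre (0 : K) = 0.
Proof. by case: k. Qed.

Lemma of_real1 : of_real k 1 = 1 :> K.
Proof. by case: k. Qed.

Lemma of_realN r : of_real k (- r) = - of_real k r.
Proof. by case: k => //=; rewrite rmorphN. Qed.

Lemma of_real_eq0 r : (of_real k r == 0) = (r == 0).
Proof. by rewrite -of_real0 (can_eq (@of_realK _ k)). Qed.

Lemma sre_of_realM r a : sre (of_real k r * a) = r * sre a.
Proof. by case: k a => //= -[? ?]; rewrite /= mul0r subr0. Qed.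

Lemma sconjK : involutive (@sconj R k).
Proof. by case: k => //=; exact: conjcK. Qed.

Lemma sconj0 : sconj (0 : K) = 0.
Proof. by case: k => //=; exact: conjc0. Qed.

Lemma sconj_of_real r : sconj (of_real k r) = of_real k r.
Proof. by case: k => //=; exact: conjc_real. Qed.

Lemma sconjD a b : sconj (a + b) = sconj a + sconj b.
Proof. by case: k a b => //= a b; rewrite rmorphD. Qed.

Lemma sconjN a : sconj (- a) = - sconj a.
Proof. by case: k a => //= a; rewrite rmorphN. Qed.

Lemma sconjM a b : sconj (a * b) = sconj a * sconj b.
Proof. by case: k a b => //= a b; rewrite rmorphM. Qed.

Lemma sconjV a : sconj (a^-1) = (sconj a)^-1.
Proof. by case: k a => //= a; rewrite conjc_inv. Qed.

Lemma sconj_sum (c : nat -> K) n :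
  sconj (\sum_(i < n) c i) = \sum_(i < n) sconj (c i).
Proof.
elim: n => [|n IH]; first by rewrite !big_ord0 sconj0.
by rewrite !big_ord_recr sconjD IH.
Qed.

Lemma sre_sconj a : sre (sconj a) = sre a.
Proof. by case: k a => //= -[? ?]. Qed.

(** This turns statements about real moduli into identities in [K], where one ring computation
    serves both kinds of scalars. *)
Lemma mul_sconj a : sconj a * a = of_real k (sre `|a| ^+ 2).
Proof.
rewrite -[RHS]/(of_real k (sre `|a| ^+ 2)) expr2 of_realM sreK//.
case: k a => [a|a] /=; first by rewrite -!expr2; exact/esym/real_normK/num_real.
by rewrite mulrC -!expr2; exact/esym/sqr_normc.
Qed.

Lemma sre_norm_ge0 a : 0 <= sre `|a|.
Proof. by rewrite -(of_real_le (k := k)) of_real0 sreK. Qed.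

Lemma sre_norm_eq0 a : sre `|a| = 0 -> a = 0.
Proof.
move=> a0; apply/eqP.
by rewrite -normr_eq0 -(sreK (normr_ge0 a)) a0 of_real0.
Qed.

Lemma sre_norm_sconj a : sre `|sconj a| = sre `|a|.
Proof.
apply/eqP; rewrite -(@eqrXn2 _ 2) ?sre_norm_ge0//; apply/eqP.
by apply: (can_inj (@of_realK _ k)); rewrite -!mul_sconj sconjK mulrC.
Qed.

Lemma sre_le_norm a : sre a <= sre `|a|.
Proof.
have [a0|a0] := ltP (sre a) 0; first exact: le_trans (ltW a0) (sre_norm_ge0 a).
rewrite -(@ler_pXn2r _ 2) ?nnegrE ?sre_norm_ge0// -[leRHS](@of_realK _ k).
rewrite -mul_sconj; case: k a {a0} => [//|[a b]] /=.
by rewrite mulNr opprK -!expr2 lerDl sqr_ge0.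
Qed.

Lemma sre_normM a b : sre `|a * b| = sre `|a| * sre `|b|.
Proof. by apply: (can_inj (@of_realK _ k)); rewrite of_realM !sreK// normrM. Qed.

Lemma sconj_add a : sconj a + a = of_real k (2 * sre a).
Proof.
case: k a => [a|[a b]] /=; first by ring.
by congr Complex; [rewrite -mulr2n mulr_natl|rewrite addNr].
Qed.

Lemma sqr_norm1D a : sre `|1 + a| ^+ 2 = 1 + 2 * sre a + sre `|a| ^+ 2.
Proof.
apply: (can_inj (@of_realK _ k)); rewrite !of_realD -!mul_sconj -sconj_add.
have sconj1 : sconj (1 : K) = 1 by rewrite -of_real1 sconj_of_real.
by rewrite sconjD of_real1 sconj1; ring.
Qed.

Lemma sre_norm_le_sqr a (s : R) : 0 <= s -> sre `|a| ^+ 2 <= s ^+ 2 -> sre `|a| <= s.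
Proof. by move=> s0; rewrite ler_pXn2r ?nnegrE// sre_norm_ge0. Qed.

End scalars.

(** * The Hahn-Banach theorem *)

Section hahn_banach.
Context {R : realType} {k : scalar_kind} {V : lmodType (scalars R k)}.
Local Notation "r %:S" := (of_real k r) (at level 2, format "r %:S").

(** Graphs of partial real-linear functionals below [phi]. Domination forces single values: a
    subspace containing (0, d) with d nonzero has points (0, r d) with r d arbitrarily large. *)
Definition dominated_subspace (phi : V -> R) (G : set (V * R)) : Prop :=
  (forall p, G p -> p.2 <= phi p.1) /\
  (forall r p q, G p -> G q -> G (r%:S *: p.1 + q.1, r * p.2 + q.2)).

(** Convexity replaces sublinearity because the bound used later, half the increment of the squared
    norm, is not positively homogeneous. *)
Definition convex_fun (phi : V -> R) : Prop :=
  forall t u v, 0 <= t <= 1 ->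
    phi (t%:S *: u + (1 - t)%:S *: v) <= t * phi u + (1 - t) * phi v.

Lemma dominated_subspace0 phi G p : dominated_subspace phi G -> G p -> G (0, 0).
Proof.
move=> [_ Gc] Gp; have := Gc (-1) _ _ Gp Gp.
by rewrite of_realN of_real1 scaleN1r mulN1r !addNr.
Qed.

Lemma dominated_subspaceZ phi G r p :
  dominated_subspace phi G -> G p -> G (r%:S *: p.1, r * p.2).
Proof.
move=> GP Gp; have [_ Gc] := GP.
by have := Gc r _ _ Gp (dominated_subspace0 GP Gp); rewrite !addr0.
Qed.

(** The value at [v] must lie above every slope (u'.2 - phi(u'.1 - t' v)) / t' and below every slope
    (phi(u.1 + t v) - u.2) / t with t, t' > 0. Convexity puts the lower slopes below the upper ones,
    and the supremum of the lower ones is taken. *)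
Lemma dominated_subspaceD1 phi G (v : V) : convex_fun phi ->
  dominated_subspace phi G -> G !=set0 ->
  exists r, dominated_subspace phi
    [set p | exists t u, G u /\ p = (u.1 + t%:S *: v, u.2 + t * r)].
Proof.
move=> cphi GP [g0 Gg0]; have G0 := dominated_subspace0 GP Gg0.
have [Gphi Gc] := GP.
pose L := [set r | exists (t : R) u, [/\ 0 < t, G u &
  r = (u.2 - phi (u.1 - t%:S *: v)) / t]].
have LU (t' : R) u' (t : R) u : 0 < t' -> 0 < t -> G u' -> G u ->
    (u'.2 - phi (u'.1 - t'%:S *: v)) / t' <= (phi (u.1 + t%:S *: v) - u.2) / t.
  move=> t'0 t0 Gu' Gu; rewrite ler_pdivrMr// mulrAC ler_pdivlMr//.
  have s0 : 0 < t + t' by rewrite addr_gt0.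
  (* These weights satisfy c t' = (1 - c) t, which cancels [v] in the convex combination. *)
  pose c : R := t / (t + t').
  have c01 : 0 <= c <= 1.
    by rewrite /c divr_ge0 ?(ltW t0) ?(ltW s0)//= ler_pdivrMr// mul1r lerDl ltW.
  have c1 : 1 - c = t' / (t + t') by rewrite /c; field; rewrite gt_eqF.
  have := cphi c (u'.1 - t'%:S *: v) (u.1 + t%:S *: v) c01.
  have -> : c%:S *: (u'.1 - t'%:S *: v) + (1 - c)%:S *: (u.1 + t%:S *: v) =
      c%:S *: u'.1 + (1 - c)%:S *: u.1.
    rewrite !scalerDr scalerN !scalerA -!of_realM addrACA.
    have -> : c * t' = (1 - c) * t by rewrite c1 /c; field; rewrite gt_eqF.
    by rewrite addNr addr0.
  have := Gphi _ (Gc c _ _ Gu' (dominated_subspaceZ (1 - c) GP Gu)) => /=.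
  move=> /le_trans /[apply]; rewrite -(ler_pM2r s0) c1 /c !mulrDl.
  have sK a b : a / (t + t') * b * (t + t') = a * b by field; rewrite gt_eqF.
  by rewrite !sK; lra.
have Lne : L !=set0 by exists ((0 - phi (0 - 1%:S *: v)) / 1), 1, (0, 0).
have Lub (t : R) u : 0 < t -> G u -> ubound L ((phi (u.1 + t%:S *: v) - u.2) / t).
  by move=> t0 Gu _ [t' [u' [t'0 Gu' ->]]]; exact: LU.
have supL : has_sup L.
  by split => //; eexists; exact: (Lub 1 (0, 0)).
exists (sup L).
split=> [_ [t [u [Gu ->]]]/=|r _ _ [t [u [Gu ->]]] [t' [u' [Gu' ->]]]/=].
- have [t0|t0|->] := ltgtP t 0.
  + have tN0 : 0 < - t by rewrite oppr_gt0.
    have /(ub_le_sup supL.2) : L ((u.2 - phi (u.1 - (- t)%:S *: v)) / - t).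
      by exists (- t), u.
    rewrite ler_pdivrMr// of_realN scaleNr opprK mulrN => h.
    by lra.
  + have := sup_le_ub Lne (Lub t u t0 Gu); rewrite ler_pdivlMr// => h.
    by lra.
  + by rewrite of_real0 scale0r mul0r !addr0; exact: Gphi.
- exists (r * t + t'), (r%:S *: u.1 + u'.1, r * u.2 + u'.2); split; first exact: Gc.
  congr pair => /=; last by ring.
  by rewrite of_realD of_realM scalerDr scalerDl scalerA addrACA.
Qed.

Lemma hahn_banach phi (G0 : set (V * R)) : convex_fun phi ->
  dominated_subspace phi G0 -> G0 !=set0 ->
  exists h : V -> R, [/\ forall r u v, h (r%:S *: u + v) = r * h u + h v,
    forall v, h v <= phi v & forall p, G0 p -> h p.1 = p.2].
Proof.
move=> cphi G0P [g0 G0g0].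
pose P := [set G | dominated_subspace phi G /\ (G !=set0 -> G0 `<=` G)].
have [F FP totF|G [[GP G0G] maxG]] := @Zorn_bigcup _ P.
  split; last first.
    by move=> [p [G FG Gp]] q /((FP _ FG).2 (ex_intro _ _ Gp)) Gq; exists G.
  split=> [p [G FG]|r p q [G FG Gp] [H FH Hq]].
    exact: (FP _ FG).1.1.
  have [GH|HG] := totF _ _ FG FH.
    by exists H => //; apply: (FP _ FH).1.2 => //; exact: GH.
  by exists G => //; apply: (FP _ FG).1.2 => //; exact: HG.
(* Otherwise [G] would be empty and [G0] would properly extend it, against maximality. *)
have {}G0G : G0 `<=` G.
  apply: contrapT => nG0; apply: (maxG G0); last by split => // _ p.
  split=> //.
  by move=> p Gp; case: nG0; exact: G0G (ex_intro _ _ Gp).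
have Gg0 := G0G _ G0g0; have G00 := dominated_subspace0 GP Gg0.
(* By maximality the one-dimensional extension towards [v] adds nothing, so [v] is already in the
   domain. *)
have totG v : exists r, G (v, r).
  have [r G'P] := dominated_subspaceD1 v cphi GP (ex_intro _ _ Gg0).
  set G' := (X in dominated_subspace _ X) in G'P.
  have GG' : G `<=` G'.
    move=> p Gp; exists 0, p; split=> //.
    by rewrite of_real0 scale0r mul0r !addr0; case: p Gp.
  exists r; apply: contrapT => nG; apply: (maxG G').
    split => // G'G; apply/nG/G'G; exists 1, (0, 0); split => //=.
    by rewrite of_real1 scale1r mul1r !add0r.
  by split => // _ p /G0G/GG'.
have funG v r s : G (v, r) -> G (v, s) -> r = s.
  suff le_rs r' s' : G (v, r') -> G (v, s') -> r' <= s'.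
    by move=> ? ?; apply/eqP; rewrite eq_le !le_rs.
  move=> Gr Gs; rewrite leNgt; apply/negP => sr.
  have := GP.2 (-1) _ _ Gs Gr.
  rewrite of_realN of_real1 scaleN1r mulN1r/= addNr addrC => Gd.
  have {sr}d0 : 0 < r' - s' by rewrite subr_gt0.
  (* This multiple of (0, r' - s') has second coordinate |phi 0| + 1, which exceeds [phi 0]. *)
  have := GP.1 _ (dominated_subspaceZ ((`|phi 0| + 1) / (r' - s')) GP Gd) => /=.
  by rewrite scaler0 divfK ?gt_eqF//; have := ler_norm (phi 0); lra.
have /choice[h hG] := totG.
exists h; split => [r u v|v|[v r] /G0G Gvr].
- exact: (funG _ _ _ (hG _) (GP.2 r _ _ (hG u) (hG v))).
- exact: (GP.1 _ (hG v)).
- exact: funG (hG v) Gvr.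
Qed.

End hahn_banach.

(** * Duality functionals and semi-inner products *)

Section scalar_linear.
Context {R : realType} {k : scalar_kind} {V : lmodType (scalars R k)}.
Local Notation K := (scalars R k).

Definition scalar_linear (f : V -> K) : Prop :=
  forall a u v, f (a *: u + v) = a * f u + f v.

Lemma scalar_linear0 f : scalar_linear f -> f 0 = 0.
Proof.
move=> flin; have := flin 1 0 0; rewrite scale1r mul1r addr0 => /eqP.
by rewrite -subr_eq0 opprD addrA subrr sub0r oppr_eq0 => /eqP.
Qed.

Lemma scalar_linearZ f a u : scalar_linear f -> f (a *: u) = a * f u.
Proof. by move=> fl; have := fl a u 0; rewrite scalar_linear0// !addr0. Qed.

Lemma scalar_linearD f u v : scalar_linear f -> f (u + v) = f u + f v.
Proof. by move=> fl; have := fl 1 u v; rewrite scale1r mul1r. Qed.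

End scalar_linear.

Section duality.
Context {R : realType} {k : scalar_kind}.
Local Notation K := (scalars R k).
Local Notation "r %:S" := (of_real k r) (at level 2, format "r %:S").

Lemma sre_inj (a b : K) : (forall l : K, sre (l * a) = sre (l * b)) -> a = b.
Proof.
move=> ab; apply/eqP; rewrite -subr_eq0; apply/eqP/sre_norm_eq0/eqP.
rewrite -sqrf_eq0; apply/eqP; rewrite -[LHS](@of_realK _ k) -mul_sconj mulrBr.
by rewrite sreD sreN ab subrr.
Qed.

(** A complex-linear functional is determined by its real part [h] through f(v) = h(v) - i h(i v);
    over the reals [h] itself serves. *)
Lemma complexify (V : lmodType K) (h : V -> R) :
  (forall r u v, h (r%:S *: u + v) = r * h u + h v) ->
  exists2 f : V -> K, scalar_linear f & forall v, sre (f v) = h v.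
Proof.
move=> hlin; have hD u v : h (u + v) = h u + h v.
  by have := hlin 1 u v; rewrite of_real1 scale1r mul1r.
have h0 : h 0 = 0 by have := hD 0 0; rewrite addr0 => ?; lra.
have hZ r u : h (r%:S *: u) = r * h u.
  by have := hlin r u 0; rewrite h0 !addr0.
move: V h {hlin} hD hZ {h0}; case: k => /= V h hD hZ.
  by exists h => // a u v; rewrite hD hZ.
pose j : R[i] := (0 +i* 1)%C.
exists (fun v => (h v +i* - h (j *: v))%C) => // -[a b] u v.
have cE (c d : R) : (c +i* d)%C = real_complex R c + real_complex R d * j.
  by rewrite /j; congr Complex => /=; ring.
have hc c d w : h ((c +i* d)%C *: w) = c * h w + d * h (j *: w).
  by rewrite cE scalerDl hD hZ -scalerA hZ.
have hj c d w : h (j *: ((c +i* d)%C *: w)) = c * h (j *: w) - d * h w.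
  have -> : j *: ((c +i* d)%C *: w) = (- d +i* c)%C *: w.
    by rewrite scalerA; congr (_ *: _); rewrite /j; congr Complex => /=; ring.
  by rewrite hc; ring.
by rewrite scalerDr !hD hc hj; congr Complex => /=; ring.
Qed.

Context {V : normedModType K}.
Implicit Types (x y v w : V) (a b c : K).

(** These are the subgradients at [x] of half the squared norm. *)
Definition duality_functional x (f : V -> K) : Prop :=
  scalar_linear f /\
  forall v, rnorm x ^+ 2 + 2 * sre (f v) <= rnorm (x + v) ^+ 2.

Definition duality_value x y c : Prop :=
  forall b, rnorm x ^+ 2 + 2 * sre (b * c) <= rnorm (x + b *: y) ^+ 2.

Lemma rnorm_of_realZ (r : R) v : 0 <= r -> rnorm (r%:S *: v) = r * rnorm v.
Proof.
move=> r0; rewrite rnormZ; congr (_ * _); apply: (can_inj (@of_realK _ k)).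
by rewrite sreK// ger0_norm// -of_real0 of_real_le.
Qed.

Lemma sqr_rnorm_convex x :
  convex_fun (fun v => (rnorm (x + v) ^+ 2 - rnorm x ^+ 2) / 2).
Proof.
move=> t u v /andP[t0 t1].
have {}t1 : 0 <= 1 - t by rewrite subr_ge0.
have le : rnorm (x + (t%:S *: u + (1 - t)%:S *: v)) <=
    t * rnorm (x + u) + (1 - t) * rnorm (x + v).
  rewrite -!rnorm_of_realZ//; apply: le_trans (ler_rnormD _ _).
  rewrite !scalerDr addrACA -scalerDl -of_realD.
  by rewrite [t + _]addrC subrK of_real1 scale1r.
have {le} : rnorm (x + (t%:S *: u + (1 - t)%:S *: v)) ^+ 2 <=
    (t * rnorm (x + u) + (1 - t) * rnorm (x + v)) ^+ 2.
  by rewrite ler_pXn2r ?nnegrE ?rnorm_ge0 ?addr_ge0 ?mulr_ge0 ?rnorm_ge0.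
(* With p = |x + u| and q = |x + v|, the gap t p^2 + (1 - t) q^2 - (t p + (1 - t) q)^2 equals t (1 -
   t) (p - q)^2. *)
have := mulr_ge0 (mulr_ge0 t0 t1) (sqr_ge0 (rnorm (x + u) - rnorm (x + v))).
by nra.
Qed.

(** The bound in [duality_value] says that b y |-> Re(b c) stays below half the increment of the
    squared norm on the line of [y]; [hahn_banach] extends it and [complexify] recovers a
    scalar-valued functional. *)
Lemma duality_valueP x y c :
  duality_value x y c <-> exists2 f, duality_functional x f & f y = c.
Proof.
split=> [xyc|[f [flin fx] <- b]]; last first.
  by rewrite -(scalar_linearZ b y flin); exact: fx.
pose G0 : set (V * R) := [set p | exists b, p = (b *: y, sre (b * c))].
have G0P : dominated_subspace
    (fun v => (rnorm (x + v) ^+ 2 - rnorm x ^+ 2) / 2) G0.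
  split=> [_ [b ->]/=|r _ _ [a ->] [b ->]/=]; first by have := xyc b; lra.
  exists (r%:S * a + b).
  by rewrite scalerDl scalerA mulrDl sreD -mulrA sre_of_realM.
have G0n : G0 !=set0 by exists (0 *: y, sre (0 * c)), 0.
have [h [hlin hle hG]] := hahn_banach (@sqr_rnorm_convex x) G0P G0n.
have [f flin fh] := complexify hlin.
exists f; first by split=> // v; rewrite fh; have := hle v; lra.
apply: sre_inj => b; have := hG (b *: y, sre (b * c)) => /= <-; last by exists b.
by rewrite -fh scalar_linearZ.
Qed.

End duality.

Section duality_theory.
Context {R : realType} {k : scalar_kind} {V : normedModType (scalars R k)}.
Local Notation K := (scalars R k).
Local Notation "r %:S" := (of_real k r) (at level 2, format "r %:S").
Implicit Types (x y v w : V) (a b c : K) (f : V -> K).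

Lemma sqr_sre_normZ (r : R) a : sre `|r%:S * a| ^+ 2 = r ^+ 2 * sre `|a| ^+ 2.
Proof.
apply: (can_inj (@of_realK _ k)); rewrite of_realM -!mul_sconj expr2 of_realM.
by rewrite sconjM sconj_of_real; ring.
Qed.

(** Insert b = t conj(c) with t = 1 / (|M| + 1). Since t M < 1, a nonzero c would give 2 t |c|^2 <=
    t^2 |c|^2 M < t |c|^2. *)
Lemma linear_le_quadratic_eq0 c (M : R) :
  (forall b, 2 * sre (b * c) <= sre `|b| ^+ 2 * M) -> c = 0.
Proof.
move=> h; apply: sre_norm_eq0; apply/eqP; rewrite -sqrf_eq0 eq_le sqr_ge0 andbT.
rewrite leNgt; apply/negP => c0.
have N0 : 0 < `|M| + 1 by rewrite ltr_wpDl.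
have := h ((`|M| + 1)^-1%:S * sconj c).
rewrite sqr_sre_normZ sre_norm_sconj -mulrA mul_sconj -of_realM of_realK.
have t0 : 0 < (`|M| + 1)^-1 by rewrite invr_gt0.
have tM : (`|M| + 1)^-1 * M < 1.
  by rewrite mulrC ltr_pdivrMr// mul1r; have := ler_norm M; lra.
have := mulr_gt0 (mulr_gt0 t0 c0) (_ : 0 < 1 - (`|M| + 1)^-1 * M).
by rewrite subr_gt0 => /(_ tM); have := mulr_gt0 t0 c0; nra.
Qed.

(** The increment v = b x bounds 2 Re(b (f(x) - |x|^2)) by |b|^2 |x|^2 for every b. *)
Lemma duality_functional_self x f :
  duality_functional x f -> f x = (rnorm x ^+ 2)%:S.
Proof.
move=> [flin fx]; apply/eqP; rewrite -subr_eq0; apply/eqP.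
apply: (@linear_le_quadratic_eq0 _ (rnorm x ^+ 2)) => b.
have := fx (b *: x).
have -> : x + b *: x = (1 + b) *: x by rewrite scalerDl scale1r.
rewrite rnormZ exprMn sqr_norm1D scalar_linearZ//.
by rewrite mulrBr sreD sreN [b * _%:S]mulrC sre_of_realM; lra.
Qed.

(** The increment v = b w - x gives 2 Re(b f(w)) <= |b|^2 |w|^2 + |x|^2; the choice b = conj(f(w)) /
    |w|^2 optimizes it. *)
Lemma duality_functional_le x f w :
  duality_functional x f -> sre `|f w| <= rnorm x * rnorm w.
Proof.
move=> fx; have [flin fle] := fx.
have fb b : 2 * sre (b * f w) <= sre `|b| ^+ 2 * rnorm w ^+ 2 + rnorm x ^+ 2.
  have := fle (b *: w - x); rewrite addrCA subrr addr0 rnormZ exprMn.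
  rewrite [b *: w - x]addrC -scaleN1r flin (duality_functional_self fx).
  rewrite scalar_linearZ//.
  by rewrite mulN1r sreD sreN of_realK; lra.
apply: sre_norm_le_sqr; first by rewrite mulr_ge0 ?rnorm_ge0.
have [w0|w0] := eqVneq (rnorm w) 0.
  rewrite (rnorm_eq0 w0) scalar_linear0// normr0 sre0 expr0n/=.
  exact: sqr_ge0.
have {}w0 : 0 < rnorm w ^+ 2 by rewrite exprn_even_gt0.
have := fb ((rnorm w ^+ 2)^-1%:S * sconj (f w)).
rewrite sqr_sre_normZ sre_norm_sconj -mulrA mul_sconj -of_realM of_realK.
rewrite -(ler_pM2r w0) exprMn.
set W := rnorm w ^+ 2 in w0 *; set F := sre `|f w| ^+ 2; set X := rnorm x ^+ 2.
have -> : 2 * (W^-1 * F) * W = 2 * F by field; rewrite gt_eqF.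
have -> : (W^-1 ^+ 2 * F * W + X) * W = F + X * W by field; rewrite gt_eqF.
by lra.
Qed.

Lemma duality_functionalP x f :
  duality_functional x f <->
  [/\ scalar_linear f, f x = (rnorm x ^+ 2)%:S
    & forall w, sre `|f w| <= rnorm x * rnorm w].
Proof.
split=> [fx|[flin fxx fle]].
  split; [exact: fx.1|exact: duality_functional_self|].
  by move=> w; exact: duality_functional_le.
(* |x|^2 + Re f(v) = Re f(x + v) is at most |x| |x + v|, hence at most half of |x|^2 + |x + v|^2. *)
split=> // v; have := sre_le_norm (f (x + v)); have := fle (x + v).
rewrite scalar_linearD// fxx sreD of_realK.
have := sqr_ge0 (rnorm x - rnorm (x + v)).
by nra.
Qed.

(** Extending the zero functional from the trivial subspace is enough, since the defining inequality
    already fixes f(x). *)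
Lemma duality_functional_ex x : exists f, duality_functional x f.
Proof.
suff /duality_valueP[f fx _] : duality_value x 0 0 by exists f.
by move=> b; rewrite mulr0 sre0 scaler0 mulr0 !addr0.
Qed.

Lemma duality_functional0 f w : duality_functional 0 f -> f w = 0.
Proof.
move=> /(duality_functional_le w); rewrite rnorm0 mul0r => fw0.
by apply: sre_norm_eq0; apply/eqP; rewrite eq_le fw0 sre_norm_ge0.
Qed.

Lemma duality_functionalZ a x f :
  duality_functional (a *: x) f -> f x = sconj a * (rnorm x ^+ 2)%:S.
Proof.
have [->|a0] := eqVneq a 0.
  by rewrite scale0r sconj0 mul0r; exact: duality_functional0.
move=> fax; apply: (mulfI a0); rewrite -scalar_linearZ; last exact: fax.1.
rewrite (duality_functional_self fax) rnormZ exprMn of_realM -mul_sconj.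
by rewrite mulrA [a * _]mulrC.
Qed.

(** On a single line the duality value is unique in either order, which makes a component
    proportional to that of [x] a computable counterweight. *)
Lemma duality_value_scale a b x c :
  duality_value (a *: x) (b *: x) c <-> c = b * (sconj a * (rnorm x ^+ 2)%:S).
Proof.
split=> [/duality_valueP[f fax <-]|->].
  by rewrite scalar_linearZ ?(duality_functionalZ fax)//; exact: fax.1.
have [f fax] := duality_functional_ex (a *: x).
apply/duality_valueP; exists f => //.
by rewrite scalar_linearZ ?(duality_functionalZ fax)//; exact: fax.1.
Qed.

Lemma duality_value0l y c : duality_value 0 y c <-> c = 0.
Proof.
split=> [/duality_valueP[f /duality_functional0 f0 <-]//|-> b].
by rewrite mulr0 sre0 rnorm0 expr0n mulr0 addr0 sqr_ge0.
Qed.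

Lemma duality_value0r x c : duality_value x 0 c <-> c = 0.
Proof.
split=> [/duality_valueP[f [fl _] <-]|-> b]; first exact: scalar_linear0.
by rewrite mulr0 sre0 scaler0 mulr0 !addr0.
Qed.

Lemma bj_orthP x y : bj_orth x y <-> duality_value x y 0.
Proof.
have E b : (`|x| <= `|x + b *: y|) =
    (rnorm x ^+ 2 + 2 * sre (b * 0) <= rnorm (x + b *: y) ^+ 2).
  rewrite -!rnormE of_real_le mulr0 sre0 mulr0 addr0.
  by rewrite ler_pXn2r ?nnegrE ?rnorm_ge0.
by split=> h b; [rewrite -E; exact: h|rewrite E; exact: h].
Qed.

(** Once [y, y] = |y|^2 is known, each clause other than conjugate-homogeneity constrains the
    functionals [s x] one at a time. *)
Lemma is_sipP (s : V -> V -> K) :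
  is_sip s <-> (forall x, duality_functional x (s x)) /\
               (forall a x y, s (a *: x) y = sconj a * s x y).
Proof.
have normE x : `|x| ^+ 2 = (rnorm x ^+ 2)%:S.
  by rewrite -rnormE !expr2 of_realM.
split=> [[sxx slin sZ sle]|[sJ sZ]].
  split=> [x|a x y]; last exact: sZ.
  apply/duality_functionalP; split=> [a u v||w].
  - by rewrite addrC -slin addrC.
  - by rewrite sxx normE.
  - apply: sre_norm_le_sqr; first by rewrite mulr_ge0 ?rnorm_ge0.
    rewrite -(of_real_le (k := k)) exprMn [leRHS]of_realM -!normE -!sxx.
    by apply: le_trans (sle x w); rewrite expr2 of_realM sreK.
split=> [x|x y z l|x y l|x y].
- by rewrite normE; exact: duality_functional_self.
- by rewrite [y + _]addrC (sJ x).1 addrC.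
- exact: sZ.
- rewrite !(duality_functional_self (sJ _)) -of_realM -exprMn.
  rewrite -(sreK (normr_ge0 (s x y))) expr2 -of_realM -expr2 of_real_le.
  rewrite ler_pXn2r ?nnegrE ?mulr_ge0 ?rnorm_ge0 ?sre_norm_ge0//.
  exact: duality_functional_le (sJ x).
Qed.

(* One duality functional is chosen on each line, with [f] on the line of [x],
   and conjugate-homogeneity dictates the others. *)
Lemma is_sip_ex x f : duality_functional x f ->
  exists2 s, is_sip s & forall w, s x w = f w.
Proof.
move=> fx.
pose line v := [set u : V | exists2 a, a != 0 & v = a *: u].
(* [rep v] depends on [v] only through the set [line v], hence is shared by all nonzero multiples of
   [v]; the line of [x] is represented by [x]. *)
pose rep v := if `[< line v x >] then x else xget 0 (line v).
have lineZ l v : l != 0 -> line (l *: v) = line v.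
  move=> l0; apply/seteqP; split=> u [a a0 e].
    exists (l^-1 * a); first by rewrite mulf_neq0 ?invr_eq0.
    by rewrite -scalerA -e scalerA mulVf// scale1r.
  by exists (l * a); [rewrite mulf_neq0|rewrite -scalerA -e].
have repP v : line v (rep v).
  rewrite /rep; case: asboolP => // _; apply: (@xgetPex _ 0 (line v)).
  by exists v; exists 1; rewrite ?oner_neq0 ?scale1r.
have /choice[al alP] : forall v, exists a, a != 0 /\ v = a *: rep v.
  by move=> v; have [a a0 e] := repP v; exists a.
have /choice[F FP] := duality_functional_ex.
pose G u := if u == x then f else F u.
have GP u : duality_functional u (G u) by rewrite /G; case: eqP => [->|_].
have rep0 : rep 0 = 0.
  have [a0 /esym/eqP] := alP 0; rewrite scaler_eq0 (negbTE a0) => /eqP//.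
pose s v w := sconj (al v) * G (rep v) w.
exists s; last first.
  move=> w; have repx : rep x = x.
    rewrite /rep; case: asboolP => // -[]; exists 1; rewrite ?oner_neq0//.
    by rewrite scale1r.
  (* At 0 the coefficient [al] is undetermined, but every duality functional vanishes there. *)
  have [x0|x0] := eqVneq x 0.
    move: fx (GP (rep x)); rewrite /s repx x0 => f0 G0.
    by rewrite !(duality_functional0 _ f0) (duality_functional0 _ G0) mulr0.
  have [_ /eqP] := alP x; rewrite repx -{1}[x]scale1r -subr_eq0 -scalerBl.
  rewrite scaler_eq0 (negbTE x0) orbF subr_eq0 => /eqP ax.
  by rewrite /s repx /G eqxx -ax -of_real1 sconj_of_real of_real1 mul1r.
apply/is_sipP; split=> [v|l v w].
  have [a0 ev] := alP v.
  have [Glin GE Gle] := (duality_functionalP _ _).1 (GP (rep v)).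
  apply/duality_functionalP; rewrite /s; split=> [b u w||w].
  - by rewrite Glin; ring.
  - rewrite {3}ev scalar_linearZ// GE mulrA mul_sconj -of_realM -exprMn.
    by rewrite -rnormZ -ev.
  - rewrite sre_normM sre_norm_sconj [X in _ <= rnorm X * _]ev rnormZ -mulrA.
    by rewrite ler_wpM2l ?sre_norm_ge0.
have [l0|l0] := eqVneq l 0.
  move: (GP (rep 0)); rewrite l0 scale0r sconj0 mul0r /s {1}rep0 => G0.
  by rewrite (duality_functional0 _ G0) mulr0.
have repl : rep (l *: v) = rep v by rewrite /rep lineZ.
rewrite /s repl mulrA; have [r0|r0] := eqVneq (rep v) 0.
  move: (GP (rep v)); rewrite {1}r0 => G0.
  by rewrite (duality_functional0 _ G0) !mulr0.
congr (_ * _); rewrite -sconjM; congr sconj.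
have [_ e] := alP v; have [_ /eqP] := alP (l *: v).
rewrite repl {1}e scalerA -subr_eq0 -scalerBl scaler_eq0 (negbTE r0) orbF.
by rewrite subr_eq0 => /eqP ->.
Qed.

(** By [is_sip_ex] the numbers [x, y] over all semi-inner products are exactly the duality values of
    (x, y). At y = 0, which the definition excludes, the only value is 0 in both orders. *)
Lemma left_sip_symmetricP x : left_sip_symmetric x <->
  forall y c, duality_value x y c -> duality_value y x (sconj c).
Proof.
split=> [symx y c|symx y _ s /is_sipP[sJ _]].
  have [->|y0] := eqVneq y 0.
    by rewrite duality_value0r => ->; rewrite sconj0 duality_value0l.
  move=> /duality_valueP[f /is_sip_ex[s sP sf] <-].
  have [s' /is_sipP[s'J _] e] := symx y y0 s sP.
  by apply/duality_valueP; exists (s' y); rewrite // e sf.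
have /symx/duality_valueP[f /is_sip_ex[s' sP sf] e] : duality_value x y (s x y).
  by apply/duality_valueP; exists (s x).
by exists s' => //; rewrite sf e.
Qed.

Lemma right_sip_symmetricP x : right_sip_symmetric x <->
  forall y c, duality_value y x c -> duality_value x y (sconj c).
Proof.
split=> [symx y c|symx y _ s /is_sipP[sJ _]].
  have [->|y0] := eqVneq y 0.
    by rewrite duality_value0l => ->; rewrite sconj0 duality_value0r.
  move=> /duality_valueP[f /is_sip_ex[s sP sf] <-].
  have [s' /is_sipP[s'J _] e] := symx y y0 s sP.
  by apply/duality_valueP; exists (s' x); rewrite // -sf e sconjK.
have /symx/duality_valueP[f /is_sip_ex[s' sP sf] e] : duality_value y x (s y x).
  by apply/duality_valueP; exists (s y).
by exists s' => //; rewrite sf e sconjK.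
Qed.

End duality_theory.

(** * Orthogonality in l2-sums *)

Section l2_orthogonality.
Context {R : realType} {k : scalar_kind} {X : nat -> normedModType (scalars R k)}.
Local Notation K := (scalars R k).
Local Notation "r %:S" := (of_real k r) (at level 2, format "r %:S").
Implicit Types (x y z w : l2_sum X).

Lemma l2_sumD x y n : (x + y) n = x n + y n.
Proof. by []. Qed.

Lemma l2_sumZ (a : K) x n : (a *: x) n = a *: x n.
Proof. by []. Qed.

Lemma rnorm_l2 x : rnorm x ^+ 2 = limn (series (fun n => rnorm (x n) ^+ 2)).
Proof.
rewrite /rnorm [`|x|]/(l2_sum_norm x) of_realK sqr_l2_norm//.
exact: l2_valP.
Qed.

Lemma cvg_rnorm_l2 x :
  series (fun n => rnorm (x n) ^+ 2) @ \oo --> rnorm x ^+ 2.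
Proof. by rewrite rnorm_l2; exact: l2_valP. Qed.

(** The difference of the partial sums is constant as soon as they include index [n]. *)
Lemma rnorm_l2_perturb n z w : (forall m, m <> n -> z m = w m) ->
  rnorm z ^+ 2 - rnorm w ^+ 2 = rnorm (z n) ^+ 2 - rnorm (w n) ^+ 2.
Proof.
move=> zw.
have zwlim : series (fun n => rnorm (z n) ^+ 2) N
    - series (fun n => rnorm (w n) ^+ 2) N @[N --> \oo]
    --> rnorm z ^+ 2 - rnorm w ^+ 2.
  by apply: cvgB; exact: cvg_rnorm_l2.
apply: (cvg_unique _ zwlim) => //; apply: cvg_near_cst; exists n.+1 => // N /= nN.
rewrite /series/= !big_mkord -sumrB (bigD1 (Ordinal nN))//= big1 ?addr0//.
move=> i /eqP ni; rewrite zw ?subrr// => e; apply: ni; exact/val_inj.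
Qed.

(** [X n] and [X m] are different types, so [v] is transported along n = m; uniqueness of equality
    proofs on [nat] makes the transport at n = n the identity. *)
Definition embed_fun n (v : X n) m : X m :=
  match n =P m with ReflectT e => eq_rect n X v m e | ReflectF _ => 0 end.

Lemma embed_funE n (v : X n) : embed_fun v n = v.
Proof. by rewrite /embed_fun; case: eqP => // e; rewrite (eq_axiomK e). Qed.

Lemma embed_fun_neq n (v : X n) m : m <> n -> embed_fun v m = 0.
Proof. by rewrite /embed_fun; case: eqP => // e mn; case: mn. Qed.

Lemma embed_square_summable n (v : X n) :
  square_summable (fun m => rnorm (embed_fun v m)).
Proof.
apply: (@square_summable_bound _ _ (rnorm v ^+ 2)) => N; rewrite /series/=.
rewrite big_mkord; have [nN|Nn] := ltnP n N.
  rewrite (bigD1 (Ordinal nN))//= big1 ?addr0 ?embed_funE// => i /eqP ni.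
  rewrite embed_fun_neq ?rnorm0 ?expr0n// => e; apply: ni; exact/val_inj.
rewrite big1 ?sqr_ge0// => i _; rewrite embed_fun_neq ?rnorm0 ?expr0n// => e.
by have := ltn_ord i; rewrite e ltnNge Nn.
Qed.

Definition embed n (v : X n) : l2_sum X := L2Sum (@embed_square_summable n v).

Lemma embedE n (v : X n) : embed v n = v.
Proof. exact: embed_funE. Qed.

Lemma embed_neq n (v : X n) m : m <> n -> embed v m = 0.
Proof. exact: embed_fun_neq. Qed.

Lemma embedZ n (a : K) (v : X n) : embed (a *: v) = a *: embed v.
Proof.
apply: l2_eqP => m; rewrite l2_sumZ.
have [->|/eqP mn] := eqVneq m n; first by rewrite !embedE.
by rewrite !embed_neq// scaler0.
Qed.

Lemma rnorm_l2_embed n x (v : X n) :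
  rnorm (x + embed v) ^+ 2 - rnorm x ^+ 2
    = rnorm (x n + v) ^+ 2 - rnorm (x n) ^+ 2.
Proof.
rewrite (@rnorm_l2_perturb n); last first.
  by move=> m mn; rewrite l2_sumD embed_neq// addr0.
by rewrite l2_sumD embedE.
Qed.

(** Coordinates are cleared one [embed] at a time, so that norms and values of linear functionals
    follow by induction on [N]. *)
Fixpoint tail x N : l2_sum X :=
  if N is M.+1 then tail x M + embed (- x M) else x.

Lemma tailS x N : tail x N.+1 = tail x N + embed (- x N).
Proof. by []. Qed.

Lemma tailE x N m : (N <= m)%N -> tail x N m = x m.
Proof.
elim: N => // N IH Nm; rewrite tailS l2_sumD.
by rewrite IH ?(ltnW Nm)// embed_neq ?addr0// => e; rewrite e ltnn in Nm.
Qed.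

Lemma rnorm_tail x N :
  rnorm (tail x N) ^+ 2 = rnorm x ^+ 2 - series (fun n => rnorm (x n) ^+ 2) N.
Proof.
elim: N => [|N IH]; first by rewrite /series/= big_geq// subr0.
rewrite tailS; have := rnorm_l2_embed (tail x N) (- x N).
rewrite tailE// subrr rnorm0 expr0n/= IH /series/= big_nat_recr//=.
by move: (bigop.body _ _ _) => S; lra.
Qed.

Lemma cvg_rnorm_tail x : rnorm (tail x N) @[N --> \oo] --> 0.
Proof.
have -> : (fun N => rnorm (tail x N)) = fun N => Num.sqrt (rnorm (tail x N) ^+ 2).
  by apply/funext => N; rewrite sqrtr_sqr ger0_norm// rnorm_ge0.
rewrite -(@sqrtr0 R); apply: continuous_cvg; first exact: sqrt_continuous.
under eq_fun do rewrite rnorm_tail.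
rewrite -(subrr (rnorm x ^+ 2)); apply: cvgB; first exact: cvg_cst.
exact: cvg_rnorm_l2.
Qed.

Lemma tail_sum (f : l2_sum X -> K) x N : scalar_linear f ->
  f (tail x N) = f x - \sum_(i < N) f (embed (x i)).
Proof.
move=> fl; elim: N => [|N IH]; first by rewrite big_ord0 subr0.
rewrite tailS big_ord_recr/= scalar_linearD// IH -[- x N]scaleN1r embedZ.
by rewrite scalar_linearZ// mulN1r opprD addrA.
Qed.

(** The vanishing of the sum of the c_n is tested by the real limits of Re(b S_N), uniformly in the
    scalar field. A duality functional f of [x] with f(y) = 0 yields c_n as its value on the n-th
    component of [y], and S_N = - f(tail y N) tends to 0 by boundedness. Conversely, the coordinate
    inequalities are summed and passed to the limit. *)
Lemma l2_bj_orthP x y : bj_orth x y <->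
  exists c : nat -> K, (forall n, duality_value (x n) (y n) (c n)) /\
    forall b, sre (b * \sum_(i < N) c i) @[N --> \oo] --> 0.
Proof.
split=> [/bj_orthP/duality_valueP[f fx fy0]|[c [xyc c0]]].
  have [flin fle] := fx.
  exists (fun n => f (embed (y n))); split=> [n b|b].
    have := fle (embed (b *: y n)); have := rnorm_l2_embed x (b *: y n).
    by rewrite embedZ scalar_linearZ//; lra.
  have le N : `|sre (b * \sum_(i < N) f (embed (y i)))| <=
      sre `|b| * rnorm x * rnorm (tail y N).
    have -> : \sum_(i < N) f (embed (y i)) = - f (tail y N).
      by rewrite tail_sum// fy0 sub0r opprK.
    rewrite mulrN sreN normrN; apply: (@le_trans _ _ (sre `|b * f (tail y N)|)).
      rewrite ler_norml -lerN2 opprK -sreN sre_le_norm andbT.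
      by apply: le_trans (sre_le_norm _) _; rewrite normrN.
    by rewrite sre_normM -mulrA ler_wpM2l ?sre_norm_ge0// duality_functional_le.
  apply: norm_cvg0.
  apply: (@squeeze_cvgr _ _ _ _ (cst 0)
    (fun N => sre `|b| * rnorm x * rnorm (tail y N))).
  - by apply: nearW => N; rewrite normr_ge0/= le.
  - exact: cvg_cst.
  - rewrite -(mulr0 (sre `|b| * rnorm x)); apply: cvgM; first exact: cvg_cst.
    exact: cvg_rnorm_tail.
apply/bj_orthP => b.
have lhs : series (fun n => rnorm (x n) ^+ 2) N + 2 * sre (b * \sum_(i < N) c i)
    @[N --> \oo] --> rnorm x ^+ 2 + 2 * sre (b * 0).
  apply: cvgD; first exact: cvg_rnorm_l2.
  by apply: cvgM; [exact: cvg_cst|rewrite mulr0 sre0; exact: c0].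
have xy := @cvg_rnorm_l2 (x + b *: y); apply: (ler_cvg_to lhs xy).
apply: nearW => N; elim: N => [|N IH].
  by rewrite big_ord0 mulr0 sre0 mulr0 addr0 /series/= !big_geq.
rewrite !seriesSr l2_sumD l2_sumZ.
have -> : \sum_(i < N.+1) c i = \sum_(i < N) c i + c N by rewrite big_ord_recr.
by rewrite mulrDr sreD; have := xyc N b; move: IH; lra.
Qed.

(** Away from [n] and [m] one component is 0, which forces c_i = 0; the partial sums are eventually
    c_n + c_m. *)
Lemma bj_orth_pairP n m x y : n <> m ->
  (forall i, i <> n -> i <> m -> x i = 0 \/ y i = 0) ->
  bj_orth x y <-> exists2 c, duality_value (x n) (y n) c
                           & duality_value (x m) (y m) (- c).
Proof.
move=> nm xy0.
have sumE (c : nat -> K) N : (forall i, i <> n -> i <> m -> c i = 0) ->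
    (n < N)%N -> (m < N)%N -> \sum_(i < N) c i = c n + c m.
  move=> c0 nN mN; rewrite (bigD1 (Ordinal nN))//=.
  rewrite (bigD1 (Ordinal mN))/=; last first.
    by apply/eqP => -[e]; exact: nm.
  rewrite big1 ?addr0// => i /andP[/eqP ni /eqP mi].
  by apply: c0 => e; [apply: ni|apply: mi]; exact/val_inj.
split=> [/l2_bj_orthP[c [xyc clim]]|[c xnc xmc]].
  have c0 i : i <> n -> i <> m -> c i = 0.
    move=> iN iM; have := xyc i.
    have [->|->] := xy0 i iN iM; first by move=> /duality_value0l.
    by move=> /duality_value0r.
  exists (c n) => //; suff -> : - c n = c m by exact: xyc.
  apply/eqP; rewrite eq_sym -addr_eq0 addrC; apply/eqP/sre_inj => b.
  rewrite mulr0 sre0.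
  apply: (cvg_unique _ _ (clim b)) => //.
  apply: cvg_near_cst; exists (maxn n m).+1 => // N /=.
  by rewrite gtn_max => /andP[nN mN]; rewrite sumE.
pose d i := if i == n then c else if i == m then - c else 0.
have d0 i : i <> n -> i <> m -> d i = 0.
  by move=> /eqP/negbTE iN /eqP/negbTE iM; rewrite /d iN iM.
apply/l2_bj_orthP; exists d; split=> [i|b].
  rewrite /d; case: eqP => [->//|iN]; case: eqP => [->//|iM].
  by have [->|->] := xy0 i iN iM; [exact/duality_value0l|exact/duality_value0r].
apply: cvg_near_cst; exists (maxn n m).+1 => // N /=.
rewrite gtn_max => /andP[nN mN]; rewrite sumE//.
rewrite /d eqxx; case: eqP => [e|_]; first by case: nm.
by rewrite eqxx subrr mulr0 sre0.
Qed.

Lemma bj_orth_singleP n x y : (forall i, i <> n -> x i = 0 \/ y i = 0) ->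
  bj_orth x y <-> bj_orth (x n) (y n).
Proof.
(* The index n + 1 serves as the second one; its duality value is forced to be 0. *)
move=> xy0; have nn : n <> n.+1 by apply/eqP; rewrite neq_ltn ltnSn.
rewrite (bj_orth_pairP nn); last by move=> i iN _; exact: xy0.
have dvS c : duality_value (x n.+1) (y n.+1) c <-> c = 0.
  have [->|->] := xy0 n.+1 (fun e => nn (esym e)).
    exact: duality_value0l.
  exact: duality_value0r.
rewrite bj_orthP; split=> [[c xyc /dvS/eqP]|xyn].
  by rewrite oppr_eq0 => /eqP c0; rewrite -c0.
by exists 0 => //; apply/dvS; rewrite oppr0.
Qed.

End l2_orthogonality.

(** * Symmetric points of l2-sums *)

Section symmetry.
Context {R : realType} {k : scalar_kind} {X : nat -> normedModType (scalars R k)}.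
Local Notation K := (scalars R k).
Implicit Types (x y : l2_sum X).

Lemma embed_pair n m (v : X n) (w : X m) : n <> m ->
  let z := embed v + embed w in
  [/\ z n = v, z m = w & forall i, i <> n -> i <> m -> z i = 0].
Proof.
move=> nm z; split=> [||i iN iM]; rewrite l2_sumD.
- by rewrite embedE embed_neq ?addr0.
- by rewrite embedE embed_neq ?add0r// => /esym.
- by rewrite !embed_neq// addr0.
Qed.

(** In the second case every index [n] has another index [m] whose nonzero component can act as a
    counterweight. *)
Lemma l2_sum_support x :
  (exists n0, forall n, n <> n0 -> x n = 0) \/
  forall n, exists2 m, n <> m & rnorm (x m) ^+ 2 != 0.
Proof.
have [|h] := pselect (exists n0, forall n, n <> n0 -> x n = 0); first by left.
right=> n; apply: contrapT => nm; apply: h; exists n => m mn.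
apply: rnorm_eq0; apply/eqP; rewrite -sqrf_eq0; apply: contrapT => xm.
by apply: nm; exists m; [exact: nesym|exact/negP].
Qed.

Lemma left_symmetric_sip x : (forall n, left_sip_symmetric (x n)) ->
  left_symmetric x.
Proof.
move=> symx y /l2_bj_orthP[c [xyc c0]]; apply/l2_bj_orthP.
exists (fun n => sconj (c n)); split=> [n|b].
  exact: (left_sip_symmetricP _).1 (xyc n).
(* Conjugating inside the real part moves the conjugation from the c_i to [b]. *)
rewrite (_ : (fun N => _) = fun N => sre (sconj b * \sum_(i < N) c i)).
  exact: c0.
by apply/funext => N; rewrite -sconj_sum -sre_sconj sconjM sconjK.
Qed.

Lemma right_symmetric_sip x : (forall n, right_sip_symmetric (x n)) ->
  right_symmetric x.
Proof.
move=> symx y /l2_bj_orthP[c [yxc c0]]; apply/l2_bj_orthP.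
exists (fun n => sconj (c n)); split=> [n|b].
  exact: (right_sip_symmetricP _).1 (yxc n).
rewrite (_ : (fun N => _) = fun N => sre (sconj b * \sum_(i < N) c i)).
  exact: c0.
by apply/funext => N; rewrite -sconj_sum -sre_sconj sconjM sconjK.
Qed.

(** Orthogonality with [x], in both orders, sees only the coordinate [n0]; vectors of [X n0] are
    tested through [embed]. *)
Lemma left_symmetric_single n0 x : (forall n, n <> n0 -> x n = 0) ->
  left_symmetric x <-> left_symmetric (x n0).
Proof.
move=> x0.
have xl y : bj_orth x y <-> bj_orth (x n0) (y n0).
  by apply: bj_orth_singleP => i iN; left; exact: x0.
have xr y : bj_orth y x <-> bj_orth (y n0) (x n0).
  by apply: bj_orth_singleP => i iN; right; exact: x0.
split=> [symx y|symx y /xl /symx /xr//].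
by rewrite -{1 2}(embedE y) => /xl /symx /xr.
Qed.

Lemma right_symmetric_single n0 x : (forall n, n <> n0 -> x n = 0) ->
  right_symmetric x <-> right_symmetric (x n0).
Proof.
move=> x0.
have xl y : bj_orth x y <-> bj_orth (x n0) (y n0).
  by apply: bj_orth_singleP => i iN; left; exact: x0.
have xr y : bj_orth y x <-> bj_orth (y n0) (x n0).
  by apply: bj_orth_singleP => i iN; right; exact: x0.
split=> [symx y|symx y /xr /symx /xl//].
by rewrite -{1 2}(embedE y) => /xr /symx /xl.
Qed.

(* The component [y] at [n] is balanced by a multiple of [x m] at [m], whose
   duality value against [x m] is forced in both orders. *)
Lemma left_sip_symmetric_component n m x : n <> m -> rnorm (x m) ^+ 2 != 0 ->
  left_symmetric x -> left_sip_symmetric (x n).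
Proof.
move=> nm xm symx; apply/left_sip_symmetricP => y c xyc.
set N := rnorm (x m) ^+ 2 in xm.
have NS : of_real k N != 0 by rewrite of_real_eq0.
(* The value of [mu *: x m] against [x m] is mu N = - c. In the reverse order it is conj(mu) N = -
   conj(c), which forces d = conj(c). *)
pose mu : K := - c / of_real k N.
have [zn zm z0] := embed_pair y (mu *: x m) nm.
set z := (embed _ + _ : l2_sum X) in zn zm z0.
have : bj_orth x z.
  apply/(bj_orth_pairP nm) => [i iN iM|]; first by right; exact: z0.
  exists c; rewrite ?zn// zm -{1}(scale1r (x m)).
  apply/duality_value_scale.
  by rewrite -of_real1 sconj_of_real of_real1 mul1r /mu divfK.
move=> /symx/(bj_orth_pairP nm)[i iN iM|d]; first by left; exact: z0.
rewrite zn zm => yxd; rewrite -{2}(scale1r (x m)).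
move=> /duality_value_scale; rewrite mul1r -/N /mu sconjM sconjV sconj_of_real.
by rewrite divfK// sconjN => /oppr_inj <-.
Qed.

Lemma right_sip_symmetric_component n m x : n <> m -> rnorm (x m) ^+ 2 != 0 ->
  right_symmetric x -> right_sip_symmetric (x n).
Proof.
move=> nm xm symx; apply/right_sip_symmetricP => y c yxc.
set N := rnorm (x m) ^+ 2 in xm.
have NS : of_real k N != 0 by rewrite of_real_eq0.
(* Here [z] comes first, so the value at [m] is conj(mu) N = - c, whence the conjugate in [mu]; the
   reverse order gives mu N = - conj(c). *)
pose mu : K := - sconj c / of_real k N.
have [zn zm z0] := embed_pair y (mu *: x m) nm.
set z := (embed _ + _ : l2_sum X) in zn zm z0.
have : bj_orth z x.
  apply/(bj_orth_pairP nm) => [i iN iM|]; first by left; exact: z0.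
  exists c; rewrite ?zn// zm -{2}(scale1r (x m)).
  apply/duality_value_scale.
  by rewrite mul1r -/N /mu sconjM sconjV sconj_of_real divfK// sconjN sconjK.
move=> /symx/(bj_orth_pairP nm)[i iN iM|d]; first by right; exact: z0.
rewrite zn zm => xyd; rewrite -{1}(scale1r (x m)).
move=> /duality_value_scale; rewrite -of_real1 sconj_of_real of_real1 mul1r.
by rewrite -/N /mu divfK// => /oppr_inj <-.
Qed.

End symmetry.

Theorem theorem23 (R : realType) (k : scalar_kind)
    (X : nat -> normedModType (scalars R k))
    (X_nontrivial : forall n, exists v : X n, v != 0)
    (x : l2_sum X) :
  (left_symmetric x <->
     (forall n, left_sip_symmetric (x n)) \/
     (exists n0, (forall n, n <> n0 -> x n = 0) /\ left_symmetric (x n0))) /\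
  (right_symmetric x <->
     (forall n, right_sip_symmetric (x n)) \/
     (exists n0, (forall n, n <> n0 -> x n = 0) /\ right_symmetric (x n0))).
Proof.
have [[n0 x0]|xn] := l2_sum_support x.
  split; split=> [symx|[symx|[n1 [x1 symx]]]].
  - by right; exists n0; split=> //; apply/left_symmetric_single.
  - exact: left_symmetric_sip.
  - exact/(left_symmetric_single x1).
  - by right; exists n0; split=> //; apply/right_symmetric_single.
  - exact: right_symmetric_sip.
  - exact/(right_symmetric_single x1).
split; split=> [symx|[symx|[n1 [x1 symx]]]].
- by left=> n; have [m nm xm] := xn n; exact: left_sip_symmetric_component nm xm _.
- exact: left_symmetric_sip.
- exact/(left_symmetric_single x1).
- by left=> n; have [m nm xm] := xn n; exact: right_sip_symmetric_component nm xm _.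
- exact: right_symmetric_sip.
- exact/(right_symmetric_single x1).
Qed.
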